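(* Let $\mathbb{T}_1,\mathbb{T}_2$ be time scales, let $0\le\alpha\le 1$, let $a,b\in\mathbb{T}_1$ with $a<b$ and $c,d\in\mathbb{T}_2$ with $c<d$, and let $f:[a,b]\times[c,d]\to\mathbb{R}$ (where $[a,b]$ and $[c,d]$ are intervals in $\mathbb{T}_1$ and $\mathbb{T}_2$ respectively) be such that the partial mappings $f_y:[a,b]\to\mathbb{R}$, $f_y(u):=f(u,y)$, and $f_x:[c,d]\to\mathbb{R}$, $f_x(v):=f(x,v)$, defined for all $y\in[c,d]$ and $x\in[a,b]$, are continuous and convex. Put $t_\alpha:=\frac{1}{b-a}\int_a^b t\,\Diamond_\alpha t$ and $s_\alpha:=\frac{1}{d-c}\int_c^d s\,\Diamond_\alpha s$. Then $$\frac{1}{b-a}\int_a^b\big[f(x,c)+f(x,d)\big]\Diamond_\alpha x+\frac{1}{d-c}\int_c^d\big[f(a,y)+f(b,y)\big]\Diamond_\alpha y\le A_1f(a,c)+A_2f(a,d)+A_3f(b,c)+A_4f(b,d),$$ where $A_1=\frac{b-t_\alpha}{b-a}+\frac{d-s_\alpha}{d-c}$, $A_2=\frac{b-t_\alpha}{b-a}+\frac{s_\alpha-c}{d-c}$, $A_3=\frac{t_\alpha-a}{b-a}+\frac{d-s_\alpha}{d-c}$, and $A_4=\frac{t_\alpha-a}{b-a}+\frac{s_\alpha-c}{d-c}$.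
   Context: A time scale $\mathbb{T}$ is a nonempty closed subset of $\mathbb{R}$ with the subspace topology. For $a\le b$ in $\mathbb{T}$, $[a,b]=\{t\in\mathbb{T}:a\le t\le b\}$. The jump operators are $\sigma(t)=\inf\{s\in\mathbb{T}:s>t\}$ and $\rho(t)=\sup\{s\in\mathbb{T}:s<t\}$, with $\inf\emptyset=\sup\mathbb{T}$ and $\sup\emptyset=\inf\mathbb{T}$. $\mathbb{T}^k$ is $\mathbb{T}$ minus its maximum if $\mathbb{T}$ has a maximum $t$ with $\rho(t)<t$, and $\mathbb{T}^k=\mathbb{T}$ otherwise; $\mathbb{T}_k$ is $\mathbb{T}$ minus its minimum if $\mathbb{T}$ has a minimum $t$ with $\sigma(t)>t$, and $\mathbb{T}_k=\mathbb{T}$ otherwise. Delta derivative at $t\in\mathbb{T}^k$: the number $f^\Delta(t)$ (if it exists) such that for every $\epsilon>0$ there is a neighborhood $U$ of $t$ in $\mathbb{T}$ with $|f(\sigma(t))-f(s)-f^\Delta(t)(\sigma(t)-s)|\le\epsilon|\sigma(t)-s|$ for all $s\in U$. Nabla derivative $f^\nabla(t)$ at $t\in\mathbb{T}_k$: the same with $\rho$ in place of $\sigma$. If $F^\Delta=f$ on $\mathbb{T}^k$, then $\int_a^b f(t)\,\Delta t=F(b)-F(a)$; if $G^\nabla=g$ on $\mathbb{T}_k$, then $\int_a^b g(t)\,\nabla t=G(b)-G(a)$. For functions given only on $[a,b]$, the integrals over $[a,b]$ are taken with $[a,b]$ as the underlying time scale. For $0\le\alpha\le1$, $\int_a^b f(s)\,\Diamond_\alpha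 s=\alpha\int_a^b f(s)\,\Delta s+(1-\alpha)\int_a^b f(s)\,\nabla s$. A function $g$ on an interval $I$ of a time scale is convex if $g(\lambda u+(1-\lambda)v)\le\lambda g(u)+(1-\lambda)g(v)$ for all $u,v\in I$ and all $\lambda\in[0,1]$ with $\lambda u+(1-\lambda)v\in I$. *)

(* Defs.v *)
From HB Require Import structures.
From mathcomp Require Import all_boot all_order all_algebra.
From mathcomp Require Import all_classical all_reals all_analysis.

Set Implicit Arguments.
Unset Strict Implicit.
Unset Printing Implicit Defensive.

Import Order.TTheory GRing.Theory Num.Theory.
Import numFieldNormedType.Exports.

Local Open Scope classical_set_scope.
Local Open Scope ring_scope.

Section TimeScale.
Context {R : realType}.
Implicit Types (T I : set R) (f F g : R -> R) (a b t D alpha : R).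

(* Functions on a time scale T are represented by total functions R -> R; the
   notions below only depend on their values on T. *)
Definition time_scale T : Prop := T !=set0 /\ closed T.

Definition ts_itv T a b : set R := T `&` `[a, b].

(* [inf set0] and [sup set0] are both 0 in the library, so the conventions
   inf {} = sup T and sup {} = inf T have to be explicit. *)
Definition ts_sigma T t : R :=
  if `[< exists2 s, T s & t < s >] then inf [set s | T s /\ t < s] else sup T.

Definition ts_rho T t : R :=
  if `[< exists2 s, T s & s < t >] then sup [set s | T s /\ s < t] else inf T.

(* T^k, where [T t /\ ubound T t] says that t is the maximum of T. *)
Definition ts_upk T : set R :=
  T `\` [set t | (T t /\ ubound T t) /\ ts_rho T t < t].

(* T_k, where [T t /\ lbound T t] says that t is the minimum of T. *)
Definition ts_downk T : set R :=
  T `\` [set t | (T t /\ lbound T t) /\ t < ts_sigma T t].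

Definition is_delta_derive T F t D : Prop :=
  forall e : R, 0 < e -> \forall s \near within T (nbhs t),
    `|F (ts_sigma T t) - F s - D * (ts_sigma T t - s)|
      <= e * `|ts_sigma T t - s|.

Definition is_nabla_derive T F t D : Prop :=
  forall e : R, 0 < e -> \forall s \near within T (nbhs t),
    `|F (ts_rho T t) - F s - D * (ts_rho T t - s)|
      <= e * `|ts_rho T t - s|.

Definition delta_antiderivative T f F : Prop :=
  forall t, ts_upk T t -> is_delta_derive T F t (f t).

Definition nabla_antiderivative T f F : Prop :=
  forall t, ts_downk T t -> is_nabla_derive T F t (f t).

(* The integral is F b - F a for an antiderivative F on the time scale T, and
   the junk value 0 if f has no antiderivative. *)
Definition delta_int T f a b : R :=
  xget 0 [set v | exists2 F, delta_antiderivative T f F & v = F b - F a].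

Definition nabla_int T f a b : R :=
  xget 0 [set v | exists2 F, nabla_antiderivative T f F & v = F b - F a].

Definition diamond_int alpha T f a b : R :=
  alpha * delta_int T f a b + (1 - alpha) * nabla_int T f a b.

(* The intermediate point is required to lie in I, which need not be convex
   as a subset of R. *)
Definition ts_convex I g : Prop :=
  forall u v l : R, I u -> I v -> 0 <= l <= 1 -> I (l * u + (1 - l) * v) ->
    g (l * u + (1 - l) * v) <= l * g u + (1 - l) * g v.

End TimeScale.

(* Main.v *)
Require Import Defs.
From HB Require Import structures.
From mathcomp Require Import all_boot all_order all_algebra.
From mathcomp Require Import all_classical all_reals all_analysis.
From mathcomp Require Import measurable_realfun.
From mathcomp Require Import ring lra.

Set Implicit Arguments.
Unset Strict Implicit.
Unset Printing Implicit Defensive.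

Import Order.TTheory GRing.Theory Num.Theory.
Import numFieldNormedType.Exports.

Local Open Scope classical_set_scope.
Local Open Scope ring_scope.

(** Apply a Hermite-Hadamard inequality on a time scale to the two functions
    [x |-> f x c + f x d] and [y |-> f a y + f b y], and add the results.
    Each of these functions is continuous and convex, and the two right-hand
    sides regroup into the four corner values of [f].

    The Hermite-Hadamard inequality itself ([diamond_hermite_hadamard]) is the
    integral of the chord bound: a convex [g] lies below the affine function
    [k t + q] that agrees with it at [a] and [b], so its integral is at most
    [k] times the integral of [t] plus [q (b - a)].  The whole difficulty is in
    this integration step, because integrals are defined by antiderivatives
    (with a junk value when there is none), and because the integral of [t]
    is taken over the full time scale while the integral of [g] is taken over
    [[a, b]].  Three facts carry it.

    Monotonicity ([delta_primitive_le]): by induction along the closed set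
    [[a, b]], a continuous function whose delta derivative is nonpositive on
    [[a, b[] does not increase from [a] to [b].  Applied to the difference of
    two antiderivatives it gives both the comparison of integrals and their
    independence of the antiderivative.  Since only derivatives on [[a, b[] and
    continuity at [b] enter, antiderivatives on the full time scale and on
    [[a, b]] can be compared, although they see different jumps at [b].

    Existence ([delta_antiderivative_exists]): send each real [u] to the last
    point of the time scale not exceeding it.  The Lebesgue integral of
    [f] composed with this step map is a delta antiderivative of [f]: across a
    gap the integrand is constantly the value at the left end, and near any
    point of the time scale it is close to the value of [f] there.

    Symmetry ([nabla_int_reflect]): the reflection [t |-> - t] exchanges the two
    jump operators, so nabla integrals are delta integrals on the reflected
    time scale. *)

Section TimeScaleCalculus.
Context {R : realType}.
Implicit Types (T : set R) (f F g G p P H : R -> R).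
Implicit Types (a b t s u v w x y D k q e : R).

(** * Neighborhoods within a set *)

Lemma near_within_ballP T t (P : R -> Prop) :
  (\forall s \near within T (nbhs t), P s) <->
  exists2 d : R, 0 < d & forall s, T s -> `|t - s| < d -> P s.
Proof.
split.
  move=> /nbhs_ballP[d /= d0 h]; exists d => // s Ts ts.
  exact: h.
move=> [d d0 h]; apply/nbhs_ballP; exists d => //= s ts Ts.
exact: h.
Qed.

Lemma within_continuous_ballP T f :
  {within T, continuous f} <->
  forall t, T t -> forall e : R, 0 < e ->
    \forall s \near within T (nbhs t), `|f t - f s| < e.
Proof.
rewrite subspace_continuousP; split.
  by move=> h t Tt e e0; have /cvgrPdist_lt := h t Tt; exact.
by move=> h t Tt; apply/cvgrPdist_lt => e e0; exact: h.
Qed.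

(** * Jump operators *)

Lemma ts_sigma_ge T t : T t -> t <= ts_sigma T t.
Proof.
move=> Tt; rewrite /ts_sigma; case: asboolP => [[s Ts ts]|h].
  by apply: lb_le_inf; [exists s | move=> x [_ /ltW]].
have [->|] := eqVneq (sup T) t; first by [].
move=> _; apply: ub_le_sup => //; exists t => s Ts.
by rewrite leNgt; apply/negP => ts; apply: h; exists s.
Qed.

Lemma ts_sigma_le T t s : T s -> t < s -> ts_sigma T t <= s.
Proof.
move=> Ts ts; rewrite /ts_sigma; case: asboolP => [_|h]; last by case: h; exists s.
by apply: ge_inf => //; exists t => x [_ /ltW].
Qed.

Lemma ts_sigma_eq_max T t : T t -> ubound T t -> ts_sigma T t = t.
Proof.
move=> Tt ub; rewrite /ts_sigma; case: asboolP => [[s Ts]|_].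
  by rewrite ltNge ub.
apply/eqP; rewrite eq_le ge_sup//=; last by exists t.
by apply: ub_le_sup => //; exists t.
Qed.

Lemma closed_adherent T t : closed T ->
  (forall e : R, 0 < e -> exists2 s, T s & `|t - s| < e) -> T t.
Proof.
move=> cT h; apply: cT => B /nbhs_ballP[e /= e0 eB].
by have [s Ts ts] := h _ e0; exists s; split => //; exact: eB.
Qed.

Lemma ts_sigma_in T t : closed T -> T t -> T (ts_sigma T t).
Proof.
move=> cT Tt; have [hs|hs] := pselect (exists2 s, T s & t < s); last first.
  rewrite ts_sigma_eq_max// => s Ts.
  by rewrite leNgt; apply/negP => ts; apply: hs; exists s.
apply: closed_adherent => // e e0; rewrite /ts_sigma; case: asboolP => // _.
have hi : has_inf [set s | T s /\ t < s].
  by split; [case: hs => s Ts ts; exists s | exists t => s [_ /ltW]].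
have [s [Ts ts] sl] := inf_adherent e0 hi; exists s => //.
have : inf [set s | T s /\ t < s] <= s by apply: ge_inf => //; case: hi.
by move=> h; rewrite ltr_norml; apply/andP; split; lra.
Qed.

Lemma ts_sigma_dense T t (e : R) : closed T -> T t -> (exists2 s, T s & t < s) ->
  ts_sigma T t = t -> 0 < e -> exists s, [/\ T s, t < s & s < t + e].
Proof.
move=> cT Tt hs; rewrite /ts_sigma; case: asboolP => // _ st e0.
have hi : has_inf [set s | T s /\ t < s].
  by split; [case: hs => s Ts ts; exists s | exists t => s [_ /ltW]].
by have [s [Ts ts]] := inf_adherent e0 hi; rewrite st; exists s.
Qed.

(** * Delta differentiability *)

Lemma is_delta_deriveP T F t D :
  is_delta_derive T F t D <->
  forall e : R, 0 < e -> exists2 d : R, 0 < d & forall s, T s -> `|t - s| < d ->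
    `|F (ts_sigma T t) - F s - D * (ts_sigma T t - s)|
      <= e * `|ts_sigma T t - s|.
Proof.
by split => h e e0; [apply/near_within_ballP; exact: h|
                     apply/near_within_ballP; exact: h].
Qed.

(** Comparing the defining estimate at s with the same estimate at s := t
    bounds [F t - F s], even when the jump of t is far away. *)
Lemma delta_derive_continuous T F t D : T t -> is_delta_derive T F t D ->
  forall e : R, 0 < e -> \forall s \near within T (nbhs t), `|F t - F s| < e.
Proof.
move=> Tt /is_delta_deriveP h e e0; apply/near_within_ballP.
set w := ts_sigma T t in h *.
pose k := 2 * `|w - t| + 1.
have k0 : 0 < k by rewrite /k; have := normr_ge0 (w - t); lra.
have [d d0 hd] := h (e / 2 / k) ltac:(by rewrite !divr_gt0).
pose m := `|D| + 1.
have m0 : 0 < m by rewrite /m; have := normr_ge0 D; lra.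
exists (Num.min d (Num.min 1 (e / 2 / m))).
  by rewrite !lt_min d0 ltr01 /= !divr_gt0.
move=> s Ts; rewrite !lt_min => /and3P[sd s1 sm].
have h1 := hd s Ts sd.
have h2 := hd t Tt ltac:(by rewrite subrr normr0).
have -> : F t - F s = (F w - F s - D * (w - s)) - (F w - F t - D * (w - t))
   + D * (t - s) by ring.
apply: (le_lt_trans (ler_normD _ _)).
apply: (@le_lt_trans _ _ (e / 2 / k * k + `|D| * `|t - s|)); last first.
  rewrite divfK ?gt_eqF//.
  have : `|D| * `|t - s| < e / 2.
    have : `|t - s| * m < e / 2 by rewrite -ltr_pdivlMr.
    apply: le_lt_trans; rewrite mulrC ler_wpM2l// /m; lra.
  lra.
rewrite normrM lerD2r; apply: (le_trans (ler_normB _ _)).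
apply: (le_trans (lerD h1 h2)); rewrite -mulrDr ler_wpM2l ?ltW ?divr_gt0//.
have -> : w - s = (w - t) + (t - s) by ring.
have := ler_normD (w - t) (t - s); rewrite /k; lra.
Qed.

(** * Monotonicity *)

(** Induction along a closed set.  For a fixed slope [e > 0], let m be the
    supremum of the points up to which [H s - H a <= e * (s - a)].  Continuity
    puts m in this set, and the step hypothesis would push the bound beyond m
    if m were smaller than b.  Then [e] tends to 0. *)
Lemma closed_set_le T H a b : closed T -> T a -> T b -> a <= b ->
  (forall x, T x -> a <= x <= b) ->
  (forall t, T t -> forall e : R, 0 < e ->
     \forall s \near within T (nbhs t), `|H t - H s| < e) ->
  (forall t, T t -> t < b -> forall e : R, 0 < e ->
     exists2 r, T r /\ t < r &
       forall s, T s -> t < s <= r -> H s - H t <= e * (s - t)) ->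
  H b <= H a.
Proof.
move=> cT Ta Tb ab Tab cH step.
suff main (e : R) : 0 < e -> H b - H a <= e * (b - a).
  rewrite leNgt; apply/negP => ha.
  have e0 : 0 < (H b - H a) / 2 / (b - a + 1) by rewrite !divr_gt0//; lra.
  have := main _ e0.
  have : (H b - H a) / 2 / (b - a + 1) * (b - a) <= (H b - H a) / 2.
    rewrite mulrAC ler_pdivrMr; last lra.
    by rewrite ler_wpM2l; lra.
  lra.
move=> e0.
pose A := [set t | T t /\ forall s, T s -> s <= t -> H s - H a <= e * (s - a)].
have Aa : A a.
  split=> // s Ts sa; have /andP[h _] := Tab _ Ts.
  by have -> : s = a; [lra | rewrite !subrr mulr0].
have hA : has_sup A.
  by split; [exists a | exists b => s [Ts _]; have /andP[_] := Tab _ Ts].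
pose m := sup A.
have ubm s : A s -> s <= m by apply: ub_le_sup; case: hA.
have Tm : T m.
  apply: closed_adherent => // d d0.
  have [s As ms] := sup_adherent d0 hA; exists s; first by case: As.
  by have := ubm _ As; rewrite -/m in ms => h; rewrite ltr_norml; apply/andP; split; lra.
have lt_m s : T s -> s < m -> H s - H a <= e * (s - a).
  move=> Ts sm.
  have [r [Tr hr] rs] := sup_adherent (eps := m - s) ltac:(lra) hA.
  by apply: hr => //; rewrite -/m in rs; lra.
have Am : A m.
  split=> // s Ts; rewrite le_eqVlt => /orP[/eqP ->|]; last exact: lt_m.
  rewrite leNgt; apply/negP => hm.
  have g0 : 0 < H m - H a - e * (m - a) by lra.
  have /near_within_ballP[d d0 hd] := cH m Tm _ g0.
  have [r Ar rm] := sup_adherent d0 hA.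
  have Tr : T r by case: Ar.
  have rlm := ubm _ Ar; rewrite -/m in rm.
  have /hd : `|m - r| < d by rewrite ltr_norml; apply/andP; split; lra.
  move=> /(_ Tr); rewrite ltr_norml => /andP[_].
  have : H r - H a <= e * (r - a) by case: Ar => _; exact.
  have : e * (r - a) <= e * (m - a) by rewrite ler_wpM2l; lra.
  lra.
have /andP[am mb] := Tab _ Tm.
have hm : H m - H a <= e * (m - a) by case: Am => _; exact.
move: mb; rewrite le_eqVlt => /orP[/eqP <-//|mb].
have [r [Tr mr] hr] := step m Tm mb e e0.
suff /ubm : A r by lra.
split=> // s Ts sr; have [sm|ms] := leP s m; first by case: Am => _; exact.
have : H s - H m <= e * (s - m) by apply: hr => //; rewrite ms.
have -> : e * (s - a) = e * (s - m) + e * (m - a) by ring.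
lra.
Qed.

(** At a right-scattered point the step r is the jump; at a right-dense point
    it is a nearby point of T, where the derivative controls H. *)
Lemma delta_derive_le0_step T H t D : closed T -> T t -> (exists2 s, T s & t < s) ->
  is_delta_derive T H t D -> D <= 0 -> forall e : R, 0 < e ->
  exists2 r, T r /\ t < r &
    forall s, T s -> t < s <= r -> H s - H t <= e * (s - t).
Proof.
move=> cT Tt hs /is_delta_deriveP h D0 e e0.
have [d d0 hd] := h e e0.
have := ts_sigma_ge Tt; rewrite le_eqVlt => /orP[/eqP/esym st|st].
  have [r [Tr tr rt]] := ts_sigma_dense cT Tt hs st d0.
  exists r => // s Ts /andP[ts sr].
  have := hd s Ts ltac:(by rewrite ltr_norml; apply/andP; split; lra).
  have nts : `|t - s| = s - t by rewrite distrC gtr0_norm ?subr_gt0.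
  rewrite st nts ler_norml => /andP[h1 h2].
  have : D * (s - t) <= 0 by rewrite mulr_le0_ge0; lra.
  lra.
exists (ts_sigma T t); first by split=> //; exact: ts_sigma_in.
move=> s Ts /andP[ts sr].
have -> : s = ts_sigma T t by apply/eqP; rewrite eq_le sr ts_sigma_le.
have := hd t Tt ltac:(by rewrite subrr normr0).
rewrite (gtr0_norm (_ : 0 < ts_sigma T t - t)) ?subr_gt0//.
rewrite ler_norml => /andP[h1 h2].
have : D * (ts_sigma T t - t) <= 0 by rewrite mulr_le0_ge0; lra.
lra.
Qed.

Lemma is_delta_derive_lin T F G t D E k :
  is_delta_derive T F t D -> is_delta_derive T G t E ->
  is_delta_derive T (fun x => k * F x + G x) t (k * D + E).
Proof.
move=> /is_delta_deriveP hF /is_delta_deriveP hG; apply/is_delta_deriveP => e e0.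
pose m := `|k| + 1.
have m0 : 0 < m by rewrite /m; have := normr_ge0 k; lra.
have [d1 d10 h1] := hF (e / 2 / m) ltac:(by rewrite !divr_gt0).
have [d2 d20 h2] := hG (e / 2) ltac:(by rewrite divr_gt0).
exists (Num.min d1 d2); first by rewrite lt_min d10.
move=> s Ts; rewrite lt_min => /andP[sd1 sd2].
have {}h1 := h1 s Ts sd1; have {}h2 := h2 s Ts sd2.
set w := ts_sigma T t in h1 h2 *.
have -> : k * F w + G w - (k * F s + G s) - (k * D + E) * (w - s) =
  k * (F w - F s - D * (w - s)) + (G w - G s - E * (w - s)) by ring.
apply: (le_trans (ler_normD _ _)); rewrite normrM.
have ws := normr_ge0 (w - s).
have : `|k| * `|F w - F s - D * (w - s)| <= m * (e / 2 / m * `|w - s|).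
  by apply: ler_pM => //; rewrite /m; lra.
rewrite mulrA (mulrC m) divfK ?gt_eqF//; lra.
Qed.

Lemma is_delta_derive_id T t : is_delta_derive T id t 1.
Proof.
apply/is_delta_deriveP => e e0; exists 1 => // s Ts _.
by rewrite mul1r subrr normr0 mulr_ge0// ltW.
Qed.

Lemma is_delta_derive_sub T S F t D : S `<=` T -> ts_sigma S t = ts_sigma T t ->
  is_delta_derive T F t D -> is_delta_derive S F t D.
Proof.
move=> ST st /is_delta_deriveP h; apply/is_delta_deriveP => e e0.
have [d d0 hd] := h e e0; exists d => // s Ss sd.
by rewrite st; apply: hd => //; exact: ST.
Qed.

Lemma ts_sigma_itv T a b t : T b -> a <= t < b ->
  ts_sigma (ts_itv T a b) t = ts_sigma T t.
Proof.
move=> Tb /andP[at_ tb].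
have Sb : ts_itv T a b b by split=> //=; rewrite in_itv/= lexx andbT; lra.
rewrite /ts_sigma; case: asboolP => [_|[]]; last by exists b.
case: asboolP => [_|[]]; last by exists b.
apply/eqP; rewrite eq_le; apply/andP; split.
  apply: lb_le_inf; first by exists b.
  move=> x [Tx tx]; have [xb|bx] := leP x b.
    apply: ge_inf; first by exists t => z [_ /ltW].
    by split=> //; split=> //=; rewrite in_itv/= xb andbT; lra.
  apply: (le_trans _ (ltW bx)); apply: ge_inf => //.
  by exists t => z [_ /ltW].
apply: lb_le_inf; first by exists b.
move=> x [[Tx _] tx]; apply: ge_inf => //.
by exists t => z [_ /ltW].
Qed.

Lemma ts_rho_lt_isolated T t : T t -> ubound T t -> ts_rho T t < t ->
  forall s, T s -> `|t - s| < t - ts_rho T t -> s = t.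
Proof.
move=> Tt ub rt s Ts sd; apply/eqP; rewrite eq_le ub//= leNgt; apply/negP => st.
have : s <= ts_rho T t.
  rewrite /ts_rho; case: asboolP => [_|[]]; last by exists s.
  by apply: ub_le_sup => //; exists t => x [_ /ltW].
have nts : `|t - s| = t - s by rewrite gtr0_norm ?subr_gt0.
rewrite nts in sd; lra.
Qed.

(** A point of T outside [ts_upk T] is isolated in T, so continuity holds there
    although [delta_antiderivative] says nothing about it. *)
Lemma delta_antiderivative_continuous T f F t : T t -> delta_antiderivative T f F ->
  forall e : R, 0 < e -> \forall s \near within T (nbhs t), `|F t - F s| < e.
Proof.
move=> Tt hF e e0; have [ut|ut] := pselect (ts_upk T t).
  exact: (delta_derive_continuous Tt (hF _ ut)).
have [[_ ub] rt] : (T t /\ ubound T t) /\ ts_rho T t < t.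
  by apply: contrapT => h; apply: ut; split.
apply/near_within_ballP; exists (t - ts_rho T t); first by rewrite subr_gt0.
by move=> s Ts /(ts_rho_lt_isolated Tt ub rt Ts) ->; rewrite subrr normr0.
Qed.

(** The part of being an antiderivative on T that restricts to the interval
    from a to b: the point b may be right-scattered in T but is the maximum of
    the interval, so the delta derivative at b is lost and only continuity
    remains there. *)
Definition delta_primitive T f F a b : Prop :=
  (forall t, T t -> a <= t < b -> is_delta_derive (ts_itv T a b) F t (f t)) /\
  (forall t, ts_itv T a b t -> forall e : R, 0 < e ->
     \forall s \near within (ts_itv T a b) (nbhs t), `|F t - F s| < e).

Lemma delta_antiderivative_primitive T f F a b : T b ->
  delta_antiderivative T f F -> delta_primitive T f F a b.
Proof.
move=> Tb hF; split=> [t Tt tab|t [Tt _] e e0]; last first.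
  have /near_within_ballP[d d0 h] := delta_antiderivative_continuous Tt hF e0.
  by apply/near_within_ballP; exists d => // s [Ts _]; exact: h.
apply: (@is_delta_derive_sub T); [by move=> x [] | exact: ts_sigma_itv |].
apply: hF; split=> // -[[_ ub] _]; have := ub _ Tb; lra.
Qed.

Lemma ts_itv_idem T a b : ts_itv (ts_itv T a b) a b = ts_itv T a b.
Proof. by rewrite /ts_itv -setIA setIid. Qed.

Lemma ts_itv_closed T a b : closed T -> closed (ts_itv T a b).
Proof. by move=> cT; apply: closedI => //; exact: itv_closed. Qed.

Lemma ts_itv_left T a b : T a -> a <= b -> ts_itv T a b a.
Proof. by move=> Ta ab; split=> //=; rewrite in_itv/= lexx. Qed.

Lemma ts_itv_right T a b : T b -> a <= b -> ts_itv T a b b.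
Proof. by move=> Tb ab; split=> //=; rewrite in_itv/= lexx andbT. Qed.

(** Two functions P and G with different underlying time scales can be
    compared, as [delta_primitive] only records what they have in common. *)
Lemma delta_primitive_le T g G p P a b k q :
  closed T -> T a -> T b -> a <= b ->
  delta_primitive T g G a b -> delta_primitive T p P a b ->
  (forall t, ts_itv T a b t -> g t <= k * p t + q) ->
  G b - G a <= k * (P b - P a) + q * (b - a).
Proof.
move=> cT Ta Tb ab [dG cG] [dP cP] gp.
pose H x := - k * P x + (- q * x + G x).
suff : H b <= H a by rewrite /H; lra.
have cS := @ts_itv_closed T a b cT.
apply: (closed_set_le cS (ts_itv_left Ta ab) (ts_itv_right Tb ab) ab).
- by move=> x [_] /=; rewrite in_itv.
- move=> t St e e0.
  (* each of the three terms of [H t - H s] has to stay below e / 3 *)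
  pose m := 3 * (`|k| + `|q| + 1).
  have k0 := normr_ge0 k; have q0 := normr_ge0 q.
  have m0 : 0 < m by rewrite /m; lra.
  have rm : e / m * m = e by rewrite divfK ?gt_eqF.
  have em0 : 0 < e / m by rewrite divr_gt0.
  move: (e / m) rm em0 => r rm r0.
  have /near_within_ballP[d1 d10 h1] := cG t St _ r0.
  have /near_within_ballP[d2 d20 h2] := cP t St _ r0.
  apply/near_within_ballP; exists (Num.min (r) (Num.min d1 d2)).
    by rewrite !lt_min r0 d10.
  move=> s Ss; rewrite !lt_min => /and3P[ts sd1 sd2].
  have {}h1 := h1 s Ss sd1; have {}h2 := h2 s Ss sd2.
  have -> : H t - H s = (- k * (P t - P s) + - q * (t - s)) + (G t - G s).
    by rewrite /H; ring.
  apply: (le_lt_trans (ler_normD _ _)).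
  have := ler_normD (- k * (P t - P s)) (- q * (t - s)).
  rewrite !normrM !normrN.
  have : `|k| * `|P t - P s| <= `|k| * (r) by rewrite ler_wpM2l// ltW.
  have : `|q| * `|t - s| <= `|q| * (r) by rewrite ler_wpM2l// ltW.
  have : 0 <= `|k| * (r) by rewrite mulr_ge0// ltW.
  have : 0 <= `|q| * (r) by rewrite mulr_ge0// ltW.
  rewrite /m in rm; lra.
- move=> t St tb.
  have /andP[at_ _] : a <= t <= b by case: St => _ /=; rewrite in_itv.
  have tab : a <= t < b by rewrite at_.
  have Tt : T t by case: St.
  apply: (@delta_derive_le0_step _ _ _ (- k * p t + (- q * 1 + g t))) => //.
  + by exists b => //; exact: ts_itv_right.
  + apply: is_delta_derive_lin; first exact: dP.
    by apply: is_delta_derive_lin; [exact: is_delta_derive_id | exact: dG].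
  + by have := gp t St; lra.
Qed.

Lemma delta_intE T f F a b : closed T -> T a -> T b -> a <= b ->
  delta_antiderivative T f F -> delta_int T f a b = F b - F a.
Proof.
move=> cT Ta Tb ab hF; rewrite /delta_int; apply: xget_unique; first by exists F.
have mono U V : delta_antiderivative T f U -> delta_antiderivative T f V ->
    U b - U a <= V b - V a.
  move=> /(@delta_antiderivative_primitive _ _ _ a b Tb) hU.
  move=> /(@delta_antiderivative_primitive _ _ _ a b Tb) hV.
  have := delta_primitive_le (k := 1) (q := 0) cT Ta Tb ab hU hV.
  by rewrite !mul1r mul0r addr0; apply => t _; rewrite mul1r addr0.
by move=> _ [G hG ->]; apply/eqP; rewrite eq_le !mono.
Qed.

(** * Existence of antiderivatives *)

Definition ts_floor T u : R := sup (T `&` [set x | x <= u]).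

Lemma ts_floor_ge T s u : T s -> s <= u -> s <= ts_floor T u.
Proof. by move=> Ts su; apply: ub_le_sup; [exists u => x [] | split]. Qed.

Lemma ts_floor_le T s u : T s -> s <= u -> ts_floor T u <= u.
Proof. by move=> Ts su; apply: ge_sup; [exists s; split | move=> x []]. Qed.

Lemma ts_floor_in T s u : closed T -> T s -> s <= u -> T (ts_floor T u).
Proof.
move=> cT Ts su; apply: closed_adherent => // e e0.
have hs : has_sup (T `&` [set x | x <= u]).
  by split; [exists s; split | exists u => x []].
have [x [Tx /= xu]] := sup_adherent e0 hs; rewrite -/(ts_floor T u) => xe.
have := ts_floor_ge Tx xu => h.
by exists x => //; rewrite ltr_norml; apply/andP; split; lra.
Qed.

Lemma ts_floor_homo T s u v : T s -> s <= u -> u <= v ->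
  ts_floor T u <= ts_floor T v.
Proof.
move=> Ts su uv; apply: ge_sup; first by exists s; split.
by move=> x [Tx /= xu]; apply: ts_floor_ge => //; exact: le_trans uv.
Qed.

(** The step map is monotone only to the right of a point of T; clamping its
    argument to [[s, t]] gives a function monotone on the whole line. *)
Lemma ts_floor_measurable T s t : closed T -> T s -> s <= t ->
  measurable_fun `[s, t[ (ts_floor T).
Proof.
move=> cT Ts st; pose clamp u := Num.max s (Num.min u t).
apply: (@eq_measurable_fun _ _ _ _ _ (fun u => ts_floor T (clamp u))).
  move=> u; rewrite inE/= in_itv/= => /andP[su ut].
  by rewrite /clamp (min_idPl (ltW ut)) (max_idPr su).
apply: nondecreasing_measurable => //.
move=> u v uv; apply: (ts_floor_homo Ts); first by rewrite le_max lexx.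
by rewrite /clamp ge_max le_max lexx /= le_max le_min !ge_min uv lexx /= !orbT.
Qed.

Lemma ts_floor_integrable T f s t : closed T -> {within T, continuous f} ->
  T s -> s <= t ->
  lebesgue_measure.-integrable `[s, t[ (EFin \o (f \o ts_floor T)).
Proof.
move=> cT cf Ts st; apply: measurable_bounded_integrable => //.
- by rewrite /= lebesgue_measure_itv /=; case: ifP => // _; rewrite -EFinD ltry.
- apply: (@measurable_comp _ _ _ _ _ _ T).
  + exact: closed_measurable.
  + move=> y [u /=]; rewrite in_itv/= => /andP[su _] <-.
    exact: ts_floor_in su.
  + apply: subspace_continuous_measurable_fun => //.
    exact: closed_measurable.
  + exact: ts_floor_measurable.
- have cK : compact (ts_itv T s t).
    by rewrite /ts_itv setIC; apply: compact_closedI => //; exact: segment_compact.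
  have cfK : {within ts_itv T s t, continuous f}.
    by apply: continuous_subspaceW cf => x [].
  have /compact_bounded[M [_ hM]] := continuous_compact cfK cK.
  exists M; split; rewrite ?num_real// => M' MM' u /=.
  rewrite in_itv/= => /andP[su ut]; apply: hM => //=.
  exists (ts_floor T u) => //; split; first exact: ts_floor_in su.
  rewrite /= in_itv/= ts_floor_ge//=; apply: (le_trans _ (ltW ut)).
  exact: ts_floor_le su.
Qed.

(** With half-open intervals, areas over adjacent intervals add up, and a gap
    [[t, ts_sigma T t[] only meets its left end t. *)
Definition ts_area T f s t : R :=
  \int[lebesgue_measure]_(u in `[s, t[) f (ts_floor T u).

Lemma ts_area_rev T f s t : t <= s -> ts_area T f s t = 0.
Proof.
move=> ts; rewrite /ts_area (_ : [set` `[s, t[] = set0) ?Rintegral_set0//.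
by rewrite -subset0 => u /=; rewrite in_itv/= => /andP[su ut]; lra.
Qed.

Lemma ts_area_cat T f r s t : closed T -> {within T, continuous f} ->
  T r -> r <= s -> s <= t ->
  ts_area T f r t = ts_area T f r s + ts_area T f s t.
Proof.
move=> cT cf Tr rs st; rewrite /ts_area -Rintegral_setU//.
- by rewrite -itv_bndbnd_setU// bnd_simp.
- rewrite -itv_bndbnd_setU ?bnd_simp//.
  by apply: ts_floor_integrable => //; exact: le_trans st.
- by apply/disj_setPS => u [] /=; rewrite !in_itv/= => /andP[_ us] /andP[su _]; lra.
Qed.

Lemma ts_area_dev T f s t D e : closed T -> {within T, continuous f} ->
  T s -> s <= t -> (forall u, s <= u < t -> `|f (ts_floor T u) - D| <= e) ->
  `|ts_area T f s t - D * (t - s)| <= e * (t - s).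
Proof.
move=> cT cf Ts st h.
have len : fine (lebesgue_measure [set` `[s, t[]) = t - s :> R.
  rewrite lebesgue_measure_itv /= lte_fin; case: ltP => //= ts.
  by have -> : t = s; [lra | rewrite subrr].
have icst (c : R) : lebesgue_measure.-integrable `[s, t[ (EFin \o (cst c)).
  apply: measurable_bounded_integrable => //.
    by rewrite /= lebesgue_measure_itv /=; case: ifP => // _; rewrite -EFinD ltry.
  by exists `|c|; split; rewrite ?num_real// => M cM u _ /=; exact: ltW.
have ifl := ts_floor_integrable cT cf Ts st.
have idiff : lebesgue_measure.-integrable `[s, t[
    (EFin \o (fun u => f (ts_floor T u) - D)).
  exact: (integrableB _ ifl (icst D)).
rewrite -len -!Rintegral_cst// /ts_area -RintegralB//; last exact: icst.
apply: (le_trans (le_normr_Rintegral _ idiff)) => //.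
apply: le_Rintegral => //.
- exact: integrable_norm.
- exact: icst.
Qed.

(** The area function has the ordinary derivative [f t] at t along T, because
    the step map sends the points between s and t into the same range.  The
    increment over a gap is exactly [f t] times its length, so the delta
    estimate follows from the ordinary one as long as [`|t - s|] is at most
    [`|ts_sigma T t - s|], which holds for s close to t. *)
Theorem delta_antiderivative_exists T f : time_scale T ->
  {within T, continuous f} -> exists F, delta_antiderivative T f F.
Proof.
move=> [[t0 T0] cT] cf.
(* one of the two areas vanishes: this is the signed area from t0 to x *)
pose F x := ts_area T f t0 x - ts_area T f x t0.
have FB s t : T s -> T t -> s <= t -> F t - F s = ts_area T f s t.
  move=> Ts Tt st; rewrite /F; have [h|h] := leP t0 s.
    rewrite (ts_area_rev _ _ h) (ts_area_rev _ _ (le_trans h st)).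
    by rewrite (ts_area_cat cT cf T0 h st); ring.
  rewrite (ts_area_rev _ _ (ltW h)); have [h'|h'] := leP t0 t.
    by rewrite (ts_area_rev _ _ h') (ts_area_cat cT cf Ts (ltW h) h'); ring.
  by rewrite (ts_area_rev _ _ (ltW h')) (ts_area_cat cT cf Ts st (ltW h')); ring.
exists F => t [Tt _]; apply/is_delta_deriveP => e e0.
set w := ts_sigma T t.
have tw : t <= w := ts_sigma_ge Tt.
have jump : F w - F t = f t * (w - t).
  rewrite FB//; last exact: ts_sigma_in.
  have : `|ts_area T f t w - f t * (w - t)| <= 0 * (w - t).
    apply: ts_area_dev => // u /andP[tu uw].
    suff -> : ts_floor T u = t by rewrite subrr normr0.
    apply/eqP; rewrite eq_le ts_floor_ge// andbT leNgt; apply/negP => h.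
    have := ts_sigma_le (ts_floor_in cT Tt tu) h.
    by have := ts_floor_le Tt tu; rewrite -/w; lra.
  by rewrite mul0r normr_le0 subr_eq0 => /eqP.
have /within_continuous_ballP/(_ t Tt e e0)/near_within_ballP[d d0 hd] := cf.
exists (if w == t then d else Num.min d (w - t)).
  by case: eqVneq => // wt; rewrite lt_min d0 subr_gt0 lt_neqAle eq_sym wt.
move=> s Ts sd.
have sd' : `|t - s| < d.
  by move: sd; case: ifP => // _; rewrite lt_min => /andP[].
have sw : `|t - s| <= `|w - s|.
  move: sd; case: eqVneq => [->//|wt]; rewrite lt_min => /andP[_].
  rewrite ltr_norml => /andP[h _].
  have st : s <= t by rewrite leNgt; apply/negP => /(ts_sigma_le Ts); rewrite -/w; lra.
  by rewrite !ger0_norm; lra.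
have -> : F w - F s - f t * (w - s) = F t - F s - f t * (t - s).
  have -> : F w = F t + f t * (w - t) by rewrite -jump; ring.
  ring.
apply: (@le_trans _ _ (e * `|t - s|)); last by rewrite ler_wpM2l// ltW.
have [st|ts] := leP s t.
  rewrite FB// (ger0_norm (_ : 0 <= t - s)) ?subr_ge0//.
  rewrite ger0_norm ?subr_ge0// in sd'.
  apply: ts_area_dev => // u /andP[su ut].
  rewrite distrC ltW// hd//; first exact: ts_floor_in su.
  have := ts_floor_le Ts su; have := ts_floor_ge Ts su => h1 h2.
  by rewrite ltr_norml; apply/andP; split; lra.
have -> : F t - F s - f t * (t - s) = - (F s - F t - f t * (s - t)) by ring.
rewrite normrN FB//; last exact: ltW.
have nts : `|t - s| = s - t by rewrite distrC gtr0_norm ?subr_gt0.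
rewrite nts in sd' *.
apply: ts_area_dev => //; first exact: ltW.
move=> u /andP[tu us].
rewrite distrC ltW// hd//; first exact: ts_floor_in tu.
have := ts_floor_le Tt tu; have := ts_floor_ge Tt tu => h1 h2.
by rewrite ltr_norml; apply/andP; split; lra.
Qed.


Lemma delta_int_le T g p a b k q : time_scale T -> T a -> T b -> a <= b ->
  {within ts_itv T a b, continuous g} -> {within T, continuous p} ->
  (forall t, ts_itv T a b t -> g t <= k * p t + q) ->
  delta_int (ts_itv T a b) g a b <= k * delta_int T p a b + q * (b - a).
Proof.
move=> [T0 cT] Ta Tb ab cg cp gp.
have cS := @ts_itv_closed T a b cT.
have Sa := ts_itv_left Ta ab; have Sb := ts_itv_right Tb ab.
have [G hG] : exists G, delta_antiderivative (ts_itv T a b) g G.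
  by apply: delta_antiderivative_exists => //; split=> //; exists a.
have [P hP] := delta_antiderivative_exists (conj T0 cT) cp.
rewrite (delta_intE cS Sa Sb ab hG) (delta_intE cT Ta Tb ab hP).
apply: (delta_primitive_le cT Ta Tb ab _ _ gp).
  have := delta_antiderivative_primitive a Sb hG.
  rewrite /delta_primitive ts_itv_idem => -[dG cG]; split=> // t Tt tab.
  by apply: dG => //; split=> //=; rewrite in_itv/=; lra.
exact: delta_antiderivative_primitive.
Qed.

(** * Nabla integrals by reflection *)

Definition ts_reflect T : set R := [set x | T (- x)].

Lemma ts_reflectK T : ts_reflect (ts_reflect T) = T.
Proof. by apply/seteqP; split=> x; rewrite /ts_reflect/= opprK. Qed.

Lemma ts_reflect_image T : -%R @` T = ts_reflect T.
Proof.
apply/seteqP; split=> x.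
  by move=> [y Ty <-]; rewrite /ts_reflect/= opprK.
by move=> Tx; exists (- x) => //; rewrite opprK.
Qed.

Lemma near_within_reflect T t (P : R -> Prop) :
  (\forall s \near within T (nbhs t), P s) ->
  \forall s \near within (ts_reflect T) (nbhs (- t)), P (- s).
Proof.
move=> /near_within_ballP[d d0 h]; apply/near_within_ballP; exists d => // s Ts sd.
by apply: h => //; rewrite opprK -normrN opprD.
Qed.

Lemma ts_rho_reflect T t : ts_rho T t = - ts_sigma (ts_reflect T) (- t).
Proof.
rewrite /ts_rho /ts_sigma.
have [h|h] := pselect (exists2 s, T s & s < t).
  rewrite !asboolT//; last first.
    by case: h => s Ts st; exists (- s); rewrite /ts_reflect/= ?opprK ?ltrN2.
  rewrite /inf opprK ts_reflect_image; congr sup.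
  by apply/seteqP; split=> x [Tx tx]; split; move: Tx tx;
    rewrite /ts_reflect/= ?opprK// ltrN2.
rewrite !asboolF//; last first.
  move=> [s Ts ts]; apply: h; exists (- s) => //.
  by rewrite -ltrN2 opprK.
by rewrite /inf ts_reflect_image.
Qed.

(** The sign in front of F cancels the one coming from the inner function, so
    the derivative itself is unchanged. *)
Lemma nabla_derive_reflect T F t D :
  is_nabla_derive T F t D <->
  is_delta_derive (ts_reflect T) (fun x => - F (- x)) (- t) D.
Proof.
have E (w s : R) : `|- F (- - w) - - F (- s) - D * (- w - s)| =
    `|F w - F (- s) - D * (w - - s)|.
  rewrite opprK -normrN; congr (`|_|); ring.
have E' (w s : R) : `|- w - s| = `|w - - s|.
  by rewrite -normrN; congr (`|_|); ring.
have w : ts_sigma (ts_reflect T) (- t) = - ts_rho T t.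
  by rewrite ts_rho_reflect opprK.
split=> h e e0.
  have := near_within_reflect (h e e0); apply: filterS => s.
  by rewrite w E E'.
have := near_within_reflect (h e e0); rewrite ts_reflectK opprK; apply: filterS => s.
by rewrite w E E' opprK.
Qed.

Lemma ts_upk_reflect T t : ts_upk (ts_reflect T) (- t) <-> ts_downk T t.
Proof.
have E : ts_rho (ts_reflect T) (- t) = - ts_sigma T t.
  by rewrite ts_rho_reflect ts_reflectK opprK.
have U : ubound (ts_reflect T) (- t) <-> lbound T t.
  split=> h x Tx; last by rewrite lerNr; exact: h.
  by rewrite -lerN2; apply: h; rewrite /ts_reflect/= opprK.
rewrite /ts_upk /ts_downk /setD /= E ltrN2 U /ts_reflect /= opprK.
by [].
Qed.

Lemma nabla_antiderivative_reflect T f F :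
  nabla_antiderivative T f F <->
  delta_antiderivative (ts_reflect T) (fun x => f (- x)) (fun x => - F (- x)).
Proof.
split=> h t ht.
  rewrite -[t]opprK; apply/nabla_derive_reflect; rewrite opprK; apply: h.
  by apply/ts_upk_reflect; rewrite opprK.
apply/nabla_derive_reflect; have := h (- t); rewrite opprK; apply.
exact/ts_upk_reflect.
Qed.

Lemma nabla_int_reflect T f a b :
  nabla_int T f a b = delta_int (ts_reflect T) (fun x => f (- x)) (- b) (- a).
Proof.
rewrite /nabla_int /delta_int; congr (xget 0 _).
apply/seteqP; split=> v [F hF ->].
  exists (fun x => - F (- x)); first exact/nabla_antiderivative_reflect.
  by rewrite !opprK addrC.
exists (fun x => - F (- x)); last by rewrite opprK addrC.
apply/nabla_antiderivative_reflect.
rewrite /= (_ : (fun x => - - F (- - x)) = F)//.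
by apply/funext => x; rewrite !opprK.
Qed.

Lemma ts_reflect_closed T : closed T -> closed (ts_reflect T).
Proof.
by move=> cT; apply: (@preimage_closed _ _ -%R) => // x _; exact: oppr_continuous.
Qed.

Lemma ts_reflect_itv T a b :
  ts_reflect (ts_itv T a b) = ts_itv (ts_reflect T) (- b) (- a).
Proof.
by apply/seteqP; split=> x [Tx]; rewrite /= !in_itv/= => h; split=> //=;
  rewrite in_itv/=; move: h; rewrite lerNl lerNr andbC.
Qed.

Lemma ts_reflect_continuous T f : {within T, continuous f} ->
  {within ts_reflect T, continuous (fun x => f (- x))}.
Proof.
move=> /within_continuous_ballP h; apply/within_continuous_ballP => t Tt e e0.
by have := near_within_reflect (h _ Tt e e0); rewrite opprK.
Qed.

Lemma nabla_int_le T g p a b k q : time_scale T -> T a -> T b -> a <= b ->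
  {within ts_itv T a b, continuous g} -> {within T, continuous p} ->
  (forall t, ts_itv T a b t -> g t <= k * p t + q) ->
  nabla_int (ts_itv T a b) g a b <= k * nabla_int T p a b + q * (b - a).
Proof.
move=> [[t0 T0] cT] Ta Tb ab cg cp gp.
rewrite !nabla_int_reflect ts_reflect_itv.
have -> : b - a = - a - - b by ring.
apply: delta_int_le.
- by split; [exists (- t0); rewrite /ts_reflect/= opprK | exact: ts_reflect_closed].
- by rewrite /ts_reflect/= opprK.
- by rewrite /ts_reflect/= opprK.
- by rewrite lerN2.
- by rewrite -ts_reflect_itv; exact: ts_reflect_continuous.
- exact: ts_reflect_continuous.
- by move=> t; rewrite -ts_reflect_itv; exact: gp.
Qed.

(** * Diamond integrals and the Hermite-Hadamard inequality *)

Lemma diamond_int_le alpha T g p a b k q : 0 <= alpha <= 1 ->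
  time_scale T -> T a -> T b -> a <= b ->
  {within ts_itv T a b, continuous g} -> {within T, continuous p} ->
  (forall t, ts_itv T a b t -> g t <= k * p t + q) ->
  diamond_int alpha (ts_itv T a b) g a b <=
    k * diamond_int alpha T p a b + q * (b - a).
Proof.
move=> /andP[a0 a1] hT Ta Tb ab cg cp gp; rewrite /diamond_int.
have := ler_wpM2l a0 (delta_int_le hT Ta Tb ab cg cp gp).
have a1' : 0 <= 1 - alpha by lra.
have := ler_wpM2l a1' (nabla_int_le hT Ta Tb ab cg cp gp).
lra.
Qed.

Lemma ts_convex_chord T g a b x : T a -> T b -> a < b ->
  ts_convex (ts_itv T a b) g -> ts_itv T a b x ->
  g x <= (b - x) / (b - a) * g a + (x - a) / (b - a) * g b.
Proof.
move=> Ta Tb ab cg Sx.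
have /andP[ax xb] : a <= x <= b by case: Sx => _ /=; rewrite in_itv.
have ba : b - a != 0 by rewrite subr_eq0 gt_eqF.
have E : (b - x) / (b - a) * a + (1 - (b - x) / (b - a)) * b = x by field.
have := cg a b ((b - x) / (b - a)) (ts_itv_left Ta (ltW ab)) (ts_itv_right Tb (ltW ab)).
rewrite E => /(_ _ Sx) h.
have -> : (x - a) / (b - a) = 1 - (b - x) / (b - a) by field.
by apply: h; rewrite divr_ge0 ?ler_pdivrMr; lra.
Qed.

Lemma ts_convexD I f g : ts_convex I f -> ts_convex I g ->
  ts_convex I (fun x => f x + g x).
Proof.
by move=> cf cg u v l Iu Iv hl Il; have := cf u v l Iu Iv hl Il;
  have := cg u v l Iu Iv hl Il; lra.
Qed.

Definition diamond_mean alpha T a b : R :=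
  (b - a)^-1 * diamond_int alpha T id a b.

Theorem diamond_hermite_hadamard alpha T g a b : 0 <= alpha <= 1 ->
  time_scale T -> T a -> T b -> a < b ->
  {within ts_itv T a b, continuous g} -> ts_convex (ts_itv T a b) g ->
  (b - a)^-1 * diamond_int alpha (ts_itv T a b) g a b <=
    (b - diamond_mean alpha T a b) / (b - a) * g a +
    (diamond_mean alpha T a b - a) / (b - a) * g b.
Proof.
move=> ha hT Ta Tb ab cg vg.
have ba : b - a != 0 by rewrite subr_eq0 gt_eqF.
have ba0 : 0 < b - a by rewrite subr_gt0.
rewrite mulrC ler_pdivrMr//.
pose k := (g b - g a) / (b - a); pose q := (b * g a - a * g b) / (b - a).
have : diamond_int alpha (ts_itv T a b) g a b <=
    k * diamond_int alpha T id a b + q * (b - a).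
  apply: diamond_int_le => //; first exact: ltW.
    by apply: continuous_subspaceT => x.
  move=> t St; have := ts_convex_chord Ta Tb ab vg St.
  suff -> : k * id t + q = (b - t) / (b - a) * g a + (t - a) / (b - a) * g b by [].
  by rewrite /k /q; field.
rewrite /diamond_mean; set V := diamond_int _ _ id _ _.
suff -> : k * V + q * (b - a) =
  ((b - (b - a)^-1 * V) / (b - a) * g a + ((b - a)^-1 * V - a) / (b - a) * g b) *
    (b - a) by [].
by rewrite /k /q; field.
Qed.

End TimeScaleCalculus.
Theorem theorem3p9 (R : realType) (T1 T2 : set R)
    (hT1 : time_scale T1) (hT2 : time_scale T2)
    (alpha : R) (halpha : 0 <= alpha <= 1)
    (a b c d : R) (ha : T1 a) (hb : T1 b) (hab : a < b)
    (hc : T2 c) (hd : T2 d) (hcd : c < d)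
    (f : R -> R -> R)
    (hfy_cont : forall y, ts_itv T2 c d y ->
      {within ts_itv T1 a b, continuous (fun u => f u y)})
    (hfy_conv : forall y, ts_itv T2 c d y ->
      ts_convex (ts_itv T1 a b) (fun u => f u y))
    (hfx_cont : forall x, ts_itv T1 a b x ->
      {within ts_itv T2 c d, continuous (fun v => f x v)})
    (hfx_conv : forall x, ts_itv T1 a b x ->
      ts_convex (ts_itv T2 c d) (fun v => f x v)) :
  let t_alpha := (b - a)^-1 * diamond_int alpha T1 (fun t => t) a b in
  let s_alpha := (d - c)^-1 * diamond_int alpha T2 (fun s => s) c d in
  let A1 := (b - t_alpha) / (b - a) + (d - s_alpha) / (d - c) in
  let A2 := (b - t_alpha) / (b - a) + (s_alpha - c) / (d - c) in
  let A3 := (t_alpha - a) / (b - a) + (d - s_alpha) / (d - c) in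
  let A4 := (t_alpha - a) / (b - a) + (s_alpha - c) / (d - c) in
  (b - a)^-1 *
      diamond_int alpha (ts_itv T1 a b) (fun x => f x c + f x d) a b +
    (d - c)^-1 *
      diamond_int alpha (ts_itv T2 c d) (fun y => f a y + f b y) c d
  <= A1 * f a c + A2 * f a d + A3 * f b c + A4 * f b d.
Proof.
cbv zeta.
rewrite -[_ * diamond_int alpha T1 _ a b]/(diamond_mean alpha T1 a b).
rewrite -[_ * diamond_int alpha T2 _ c d]/(diamond_mean alpha T2 c d).
set t_alpha := diamond_mean alpha T1 a b; set s_alpha := diamond_mean alpha T2 c d.
have Sa := ts_itv_left ha (ltW hab); have Sb := ts_itv_right hb (ltW hab).
have Sc := ts_itv_left hc (ltW hcd); have Sd := ts_itv_right hd (ltW hcd).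
have X : (b - a)^-1 *
      diamond_int alpha (ts_itv T1 a b) (fun x => f x c + f x d) a b <=
    (b - t_alpha) / (b - a) * (f a c + f a d) +
    (t_alpha - a) / (b - a) * (f b c + f b d).
  apply: diamond_hermite_hadamard => //.
    by move=> x; apply: continuousD; exact: hfy_cont.
  by apply: ts_convexD; exact: hfy_conv.
have Y : (d - c)^-1 *
      diamond_int alpha (ts_itv T2 c d) (fun y => f a y + f b y) c d <=
    (d - s_alpha) / (d - c) * (f a c + f b c) +
    (s_alpha - c) / (d - c) * (f a d + f b d).
  apply: diamond_hermite_hadamard => //.
    by move=> y; apply: continuousD; exact: hfx_cont.
  by apply: ts_convexD; exact: hfx_conv.
apply: (le_trans (lerD X Y)).
lra.
Qed.
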